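(* (a) If $(X,R)$ is an almost wac tournament, then $X$ is totally disconnected. (b) If $R$ is a locally arc cyclic topological tournament on a compact space (e.g. a finite tournament), then it is wac. (c) If $R$ is a wac (or almost wac) tournament, then the reverse tournament $R^{-1}$ is wac (resp. almost wac). (d) If $(X,R)$ is a wac (or almost wac) tournament and $A$ is a nonempty clopen subset of $X$, then the restriction $R|A$ is wac (resp. almost wac). If $(X,R)$ is a wac tournament and $x\in X$, then the restriction $R|R(x)$ is almost wac with initial point $x$. (e) If $R$ is a wac tournament, then any initial or terminal point for $R$ is an isolated point. (f) Let $h:(X_2,R_2)\to(X_1,R_1)$ be a surjective continuous tournament map of topological tournaments with $(X_2,R_2)$ wac (or almost wac). Then $(X_1,R_1)$ is wac (resp. almost wac), and for every non-isolated point $y$ of $X_1$ the set $h^{-1}(y)$ is a singleton $\{x\}$ with $x$ non-isolated in $X_2$. If $x$ is a terminal (or initial) point for $R_2$, then $h(x)$ is a terminal (resp. initial) point for $R_1$. If $y$ is a terminal (or initial) point for $R_1$ and $y$ is not isolated, then $h^{-1}(y)=\{x\}$ with $x$ terminal (resp. initial) for $R_2$. If $y$ is an isolated point of $X_1$, then the restriction $R_2|h^{-1}(y)$ is wac (resp. almost wac). There is an isomorphism to the topological lexicographic product $$\hat h:(X_2,R_2)\to(X_1,R_1)\ltimes\{(h^{-1}(y),R_2|h^{-1}(y)):y\in X_1\}$$ such that $\pi\circ\hat h=h$, where $\pi$ is the coordinate projection to $X_1$; in particular, $h$ is an open map. If $(X_2,R_2)$ is arc cyclic or locally arc cyclic,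 then $(X_1,R_1)$ satisfies the corresponding condition.
   Context: All spaces are Hausdorff. A tournament on a nonempty set $X$ is a relation $R\subset X\times X$ with $R\cap R^{-1}=1_X$ (the diagonal) and $R\cup R^{-1}=X\times X$; $R^\circ=R\setminus1_X$; $R(x)=\{y:(x,y)\in R\}$, $R^\circ(x)=R(x)\setminus\{x\}$, $R^{\circ-1}(x)=\{y:(y,x)\in R^\circ\}$; $R|A=R\cap(A\times A)$. It is topological when $R$ is closed in $X\times X$. A point $x$ is terminal if $R^\circ(x)=\emptyset$ and initial if $R^{\circ-1}(x)=\emptyset$. A tournament map $h:(X_2,R_2)\to(X_1,R_1)$ is a function with $(h\times h)(R_2)\subset R_1$; an isomorphism of topological tournaments is a homeomorphism which is a tournament map. A 3-cycle is a triple of distinct points with $(x_1,x_2),(x_2,x_3),(x_3,x_1)\in R^\circ$. A cycle point is a point each of whose neighborhoods contains a 3-cycle including it. $(X,R)$ is wac when $X$ is compact, $R$ is a topological tournament, and every non-isolated point is a cycle point; almost wac when $X$ is compact, $R$ is a topological tournament, and every point is either isolated, initial, terminal or a cycle point. A subset $B\subset X$ is an arc cyclic subset if every arc $(x_1,x_2)\in R^\circ$ with $x_1,x_2\in B$ is contained in a 3-cycle $\{x_1,x_2,x_3\}$ of $X$ (with $x_3$ not necessarily in $B$). $(X,R)$ is arc cyclic if $X$ is an arc cyclic subset, and locally arc cyclic if every point has a neighborhood which is an arc cyclic subset. Topological lexicographic product $(X_1,R_1)\ltimes\{(Y_x,S_x):x\in X_1\}$ (where $Y_x$ must be a singleton whenever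 $x$ is non-isolated in $X_1$): the tournament on $\bigcup_x\{x\}\times Y_x$ with $((x,y),(x',y'))$ related iff $(x,x')\in R_1^\circ$, or $x=x'$ and $(y,y')\in S_x$; the topology has basis the sets $\pi^{-1}(V)$ with $V$ open in $X_1$ and $\{x\}\times V$ with $x$ isolated in $X_1$ and $V$ open in $Y_x$, where $\pi$ is the first coordinate projection. *)

(* Defs.v *)
From HB Require Import structures.
From mathcomp Require Import all_boot all_order all_algebra.
From mathcomp Require Import all_classical all_reals all_analysis.

Set Implicit Arguments.
Unset Strict Implicit.
Unset Printing Implicit Defensive.

Local Open Scope classical_set_scope.

Section relations.
Context {T : Type}.
Implicit Types (R : set (T * T)) (x : T).

Definition tournament R : Prop :=
  [/\ [set: T] !=set0,
      R `&` R^-1%relation = diagonal &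
      R `|` R^-1%relation = [set: T * T]].

Definition strict_rel R : set (T * T) := R `\` diagonal.

Definition out_set R x : set T := [set y | R (x, y)].

Definition terminal_point R x : Prop := [set y | strict_rel R (x, y)] = set0.

Definition initial_point R x : Prop := [set y | strict_rel R (y, x)] = set0.

Definition three_cycle R x1 x2 x3 : Prop :=
  [/\ x1 <> x2, x2 <> x3 & x3 <> x1] /\
  [/\ strict_rel R (x1, x2), strict_rel R (x2, x3) & strict_rel R (x3, x1)].

Definition arc_cyclic_subset R (B : set T) : Prop :=
  forall x1 x2, B x1 -> B x2 -> strict_rel R (x1, x2) ->
    exists x3, three_cycle R x1 x2 x3.

Definition arc_cyclic R : Prop := arc_cyclic_subset R [set: T].

(* The carrier of R|A is the subtype [set_type A]; when T is a topological
   space, [set_type A] has the subspace topology. *)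
Definition restrict_rel R (A : set T) : set (set_type A * set_type A) :=
  [set p | R (\val p.1, \val p.2)].

End relations.
Arguments restrict_rel {T} R A _.

Definition tournament_map {T2 T1 : Type} (R2 : set (T2 * T2))
    (R1 : set (T1 * T1)) (h : T2 -> T1) : Prop :=
  forall x y, R2 (x, y) -> R1 (h x, h y).

Section topological_tournaments.
Context {X : topologicalType}.
Implicit Types (R : set (X * X)) (x : X).

(* All spaces are assumed to be Hausdorff; the assumption is recorded here. *)
Definition topological_tournament R : Prop :=
  [/\ hausdorff_space X, tournament R & closed R].

Definition cycle_point R x : Prop :=
  forall U : set X, nbhs x U ->
    exists x1 x2 x3 : X, [/\ three_cycle R x1 x2 x3,
      [set x1; x2; x3] x & [set x1; x2; x3] `<=` U].

Definition wac R : Prop :=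
  [/\ compact [set: X], topological_tournament R &
      forall x, ~ isolated [set: X] x -> cycle_point R x].

Definition almost_wac R : Prop :=
  [/\ compact [set: X], topological_tournament R &
      forall x, [\/ isolated [set: X] x, initial_point R x,
                    terminal_point R x | cycle_point R x]].

Definition locally_arc_cyclic R : Prop :=
  forall x, exists2 U : set X, nbhs x U & arc_cyclic_subset R U.

End topological_tournaments.

Definition open_map {X Y : topologicalType} (f : X -> Y) : Prop :=
  forall U : set X, open U -> open (f @` U).

Definition homeomorphism {X Y : topologicalType} (f : X -> Y) : Prop :=
  continuous f /\
  exists g : Y -> X, [/\ cancel f g, cancel g f & continuous g].

Definition topological_tournament_iso {X Y : topologicalType}
    (R : set (X * X)) (S : set (Y * Y)) (f : X -> Y) : Prop :=
  [/\ topological_tournament R, topological_tournament S,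
      homeomorphism f & tournament_map R S f].

(* The same underlying type as the disjoint sum [{x : X & Y x}], under another
   name because its topology is not the disjoint sum topology of the library. *)
Definition lexprod {X : topologicalType} (Y : X -> topologicalType) : Type :=
  {x : X & Y x}.

Section lexicographic_product.
Context {X : topologicalType} {Y : X -> topologicalType}.

HB.instance Definition _ := Choice.copy (lexprod Y) {x : X & Y x}.

Definition lexprod_proj (p : lexprod Y) : X := projT1 p.

(* The product is only considered for families satisfying this condition. *)
Definition lexprod_admissible : Prop :=
  forall x, ~ isolated [set: X] x -> exists y : Y x, [set: Y x] = [set y].

Definition lexprod_base : set (set (lexprod Y)) :=
  [set lexprod_proj @^-1` V | V in open] `|`
  [set B | exists x (V : set (Y x)), [/\ isolated [set: X] x, open V &
             B = (existT Y x : Y x -> lexprod Y) @` V]].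

Let lexprod_base_cover : \bigcup_(B in lexprod_base) id B = [set: lexprod Y].
Proof.
rewrite -subTset => p _; exists setT => //; left.
by exists setT; [exact: openT|rewrite preimage_setT].
Qed.

Let lexprod_base_join (A B : set (lexprod Y)) p :
  lexprod_base A -> lexprod_base B -> id A p -> id B p ->
  exists C, [/\ lexprod_base C, id C p & id C `<=` id A `&` id B].
Proof.
move=> [[V oV <-]|[x [V [ix oV ->]]]] [[W oW <-]|[x' [W [ix' oW ->]]]] /= Ap Bp.
- exists (lexprod_proj @^-1` (V `&` W)); split => //.
  by left; exists (V `&` W) => //; exact: openI.
- exists ((existT Y x' : Y x' -> lexprod Y) @` W); split => //.
    by right; exists x', W.
  by move=> q [y Wy <-]; split; [case: Bp Ap => z _ <-|exists y].
- exists ((existT Y x : Y x -> lexprod Y) @` V); split => //.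
    by right; exists x, V.
  by move=> q [y Vy <-]; split; [exists y|case: Ap Bp => z _ <-].
- case: Ap => y Vy ep; case: Bp => y' Wy' ep'.
  have ex : x = x' by have := congr1 lexprod_proj (etrans ep (esym ep')).
  move: W oW y' Wy' ep'; rewrite -{x' ix'}ex => W oW y' Wy' ep'.
  have ey : y = y' by exact: existT_inj2 (etrans ep (esym ep')).
  exists ((existT Y x : Y x -> lexprod Y) @` (V `&` W)); split.
  + by right; exists x, (V `&` W); split => //; exact: openI.
  + by exists y => //; split => //; rewrite ey.
  + by move=> q [z [Vz Wz] <-]; split; exists z.
Qed.

HB.instance Definition _ := isBaseTopological.Build (lexprod Y)
  lexprod_base_cover lexprod_base_join.

Definition lexprod_rel (R : set (X * X)) (S : forall x, set (Y x * Y x)) :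
    set (lexprod Y * lexprod Y) :=
  [set p | strict_rel R (lexprod_proj p.1, lexprod_proj p.2) \/
           exists x (y y' : Y x), [/\ p.1 = existT Y x y,
             p.2 = existT Y x y' & S x (y, y')]].

End lexicographic_product.
Arguments lexprod_admissible {X} Y.

Definition fiber {X2 X1 : topologicalType} (h : X2 -> X1) (y : X1) :
  topologicalType := set_type (h @^-1` [set y]).

Definition fiber_rel {X2 X1 : topologicalType} (R2 : set (X2 * X2))
    (h : X2 -> X1) (y : X1) : set (fiber h y * fiber h y) :=
  restrict_rel R2 (h @^-1` [set y]).
Arguments fiber_rel {X2 X1} R2 h y _.

(* Main.v *)
Require Import Defs.
From HB Require Import structures.
From mathcomp Require Import all_boot all_order all_algebra.
From mathcomp Require Import all_classical all_reals all_analysis.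

(** Write x -> y for a strict arc.  In a tournament x -> y holds exactly when
    (y, x) is not in R, so closedness of R makes every strict out-set and
    in-set open, and every non-strict one closed.  Nearly everything rests on
    comparing the two descriptions.

    (a) For x -> y, the points z closing a 3-cycle x -> y -> z -> x form a set
    which is clopen ([clopen_three_cycle]): it is defined by two strict
    conditions, and the non-strict versions of these conditions define the same
    set because neither x nor y satisfies them.  As it misses x and y, a
    connected set contains no 3-cycle.  Moreover a point c outside a connected
    set A splits A into the clopen pieces of points before and after c, so A is
    convex: a -> c -> b with a, b in A forces c in A.  If A contained an arc
    a -> b, connectedness and the absence of 3-cycles would give x in A with
    a -> x -> b; such an x is neither isolated, initial nor terminal, and a
    small 3-cycle through x would lie strictly between a and b, hence in A: a
    contradiction.

    (b) Let points y -> x accumulate at x.  Local arc cyclicity gives z with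
    y -> x -> z -> y, with z anywhere in X.  A limit of such z as y tends to x
    satisfies both (x, z) and (z, x) in R, so it is x; by compactness z is close
    to x as soon as y is ([near_small_three_cycle]).  The other case is the same
    for the reverse tournament.

    (f) The key point is that the fiber F over a non-isolated y is a singleton.
    As h is a closed map, F is not open, so some x in F is a limit of points
    outside F.  If x -> x' with x' in F, then points z near x and outside F
    satisfy z -> x', hence h z -> y, hence z -> w for every w in F.  So x is
    neither isolated, initial nor terminal.  A 3-cycle x -> a -> b -> x near x
    must then lie in F: outside F, a would have an arc to x and b an arc to a,
    against the cycle.  But since b -> x, points z near x satisfy b -> z, and
    those outside F also satisfy z -> b.  This contradiction is
    [fiber_boundary_no_out]; with its reversal, x has no arc to or from another
    point of F.

    The other claims of (f) follow.  Cycles and extreme points are carried along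
    h, and the identification of X2 with the lexicographic product is a
    homeomorphism because the preimages of the neighborhoods of a point with
    singleton fiber form a base of neighborhoods of that fiber
    ([nbhs_preimage_fiber]).  The lexicographic tournament is the pullback of R2
    along the inverse of this homeomorphism, hence a topological tournament. *)

Set Implicit Arguments.
Unset Strict Implicit.
Unset Printing Implicit Defensive.

Local Open Scope classical_set_scope.

(** * Tournaments *)

Section tournaments.
Context {T : Type} {R : set (T * T)}.
Hypothesis tR : tournament R.

Lemma tournament_total x y : R (x, y) \/ R (y, x).
Proof.
by case: tR => _ _ /seteqP[_ /(_ (x, y) I)].
Qed.

Lemma tournament_antisym x y : R (x, y) -> R (y, x) -> x = y.
Proof. by case: tR => _ /seteqP[+ _] _ => /(_ (x, y)) + xy yx; apply. Qed.

Lemma tournament_refl x : R (x, x).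
Proof. by case: (tournament_total x x). Qed.

Lemma strict_relP x y : strict_rel R (x, y) <-> ~ R (y, x).
Proof.
split=> [[xy nxy] yx|nyx]; first exact/nxy/tournament_antisym.
have [xy|//] := tournament_total x y.
by split=> // xy_eq; apply: nyx; rewrite (xy_eq : x = y) in xy *.
Qed.

Lemma three_cycleP x y z :
  three_cycle R x y z <-> [/\ ~ R (y, x), ~ R (z, y) & ~ R (x, z)].
Proof.
split=> [[_ [/strict_relP ? /strict_relP ? /strict_relP ?]]|[yx zy xz]] //.
split; last by split; exact/strict_relP.
by split=> e; move: yx zy xz; rewrite e => yx zy xz;
  [apply: yx|apply: zy|apply: xz]; exact: tournament_refl.
Qed.

Lemma initial_pointP x : initial_point R x <-> forall y, R (x, y).
Proof.
split=> [ix y|ix].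
  apply: contrapT => /strict_relP yx.
  by have : set0 y by rewrite -ix.
by apply/seteqP; split=> // y /= /strict_relP; apply; exact: ix.
Qed.

Lemma terminal_pointP x : terminal_point R x <-> forall y, R (y, x).
Proof.
split=> [ix y|ix].
  apply: contrapT => /strict_relP yx.
  by have : set0 y by rewrite -ix.
by apply/seteqP; split=> // y /= /strict_relP; apply; exact: ix.
Qed.

End tournaments.

Lemma tournament_reverse {T : Type} (R : set (T * T)) :
  tournament R -> tournament R^-1%relation.
Proof.
move=> [T0 IR UR]; split=> //.
  by rewrite -IR; apply/seteqP; split=> -[x y] [].
by apply/seteqP; split=> // -[x y] _; have [] : (R `|` R^-1%relation) (x, y);
  rewrite ?UR //; [right|left].
Qed.

Lemma tournament_pullback {S T : Type} (R : set (T * T)) (g : S -> T) :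
  [set: S] !=set0 -> injective g -> tournament R ->
  tournament [set p : S * S | R (g p.1, g p.2)].
Proof.
move=> S0 ginj tR; split=> //; apply/seteqP; split=> -[x y] //=.
- by move=> [xy yx]; apply: ginj; exact: (tournament_antisym tR).
- by rewrite /diagonal /= => ->; split; exact: (tournament_refl tR).
- by move=> _; exact: (tournament_total tR).
Qed.

(** * Topological tournaments *)

Lemma isolatedTP {X : topologicalType} (x : X) :
  isolated [set: X] x <-> open [set x].
Proof.
split=> [[_ [V xV]]|ox].
  rewrite setIT => e; rewrite openE => y -> /=; rewrite /interior -e.
  exact: xV.
split; first by rewrite inE.
by exists [set x]; rewrite ?setIT //; exact: open_nbhs_nbhs.
Qed.

Lemma closed_pair_preimage {Z X : topologicalType} {R : set (X * X)}
    {f g : Z -> X} :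
  closed R -> continuous f -> continuous g -> closed [set z | R (f z, g z)].
Proof.
move=> cR cf cg.
have cfg : continuous (fun z => (f z, g z)).
  by move=> z; apply: cvg_pair; [exact: cf|exact: cg].
exact: ((continuous_closedP (fun z => (f z, g z))).1 cfg _ cR).
Qed.

Lemma hausdorff_injective {S T : topologicalType} (g : S -> T) :
  continuous g -> injective g -> hausdorff_space T -> hausdorff_space S.
Proof.
move=> cg ginj hT p q pq; apply/ginj/hT => A B Ap Bq.
by have [z [Az Bz]] := pq _ _ (cg _ _ Ap) (cg _ _ Bq); exists (g z).
Qed.

Lemma topological_tournament_pullback {S T : topologicalType}
    (R : set (T * T)) (g : S -> T) :
  [set: S] !=set0 -> continuous g -> injective g -> topological_tournament R ->
  topological_tournament [set p : S * S | R (g p.1, g p.2)].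
Proof.
move=> S0 cg ginj [hT tR cR]; split.
- exact: hausdorff_injective hT.
- exact: (tournament_pullback S0 ginj tR).
- apply: (closed_pair_preimage (f := g \o fst) (g := g \o snd) cR) => -[x y].
    exact: (@continuous_comp _ _ _ fst g (x, y) (@cvg_fst _ _ _ _ _) (cg _)).
  exact: (@continuous_comp _ _ _ snd g (x, y) (@cvg_snd _ _ _ _ _) (cg _)).
Qed.

Section topological_tournament_theory.
Context {X : topologicalType} {R : set (X * X)}.
Hypothesis ttR : topological_tournament R.

Let tR : tournament R. Proof. by case: ttR. Qed.
Let cR : closed R. Proof. by case: ttR. Qed.

Lemma topological_tournament_closed_set1 (x : X) : closed [set x].
Proof.
by case: ttR => hX _ _; exact/accessible_closed_set1/hausdorff_accessible.
Qed.

Lemma closed_out x : closed [set y | R (x, y)].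
Proof.
apply: (@closed_pair_preimage _ _ _ (cst x) id cR) => y;
  [exact: cvg_cst|exact: cvg_id].
Qed.

Lemma closed_in x : closed [set y | R (y, x)].
Proof.
apply: (@closed_pair_preimage _ _ _ id (cst x) cR) => y;
  [exact: cvg_id|exact: cvg_cst].
Qed.

Lemma open_strict_out x : open [set y | ~ R (y, x)].
Proof. by apply: closed_openC; exact: closed_in. Qed.

Lemma open_strict_in x : open [set y | ~ R (x, y)].
Proof. by apply: closed_openC; exact: closed_out. Qed.

Lemma nbhs_strict_out x y : ~ R (y, x) -> nbhs y [set z | ~ R (z, x)].
Proof.
by move=> yx; apply: open_nbhs_nbhs; split=> //; exact: open_strict_out.
Qed.

Lemma nbhs_strict_in x y : ~ R (x, y) -> nbhs y [set z | ~ R (x, z)].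
Proof.
by move=> xy; apply: open_nbhs_nbhs; split=> //; exact: open_strict_in.
Qed.

Lemma cycle_pointP x : cycle_point R x <->
  forall U, nbhs x U -> exists y z, [/\ U y, U z & three_cycle R x y z].
Proof.
have rot a b c : three_cycle R a b c -> three_cycle R b c a.
  by move=> /(three_cycleP tR)[? ? ?]; exact/(three_cycleP tR).
split=> [cx U /cx|cx U xU].
  move=> [a [b [c [abc xabc abcU]]]].
  have [Ua Ub Uc] : [/\ U a, U b & U c].
    by split; apply: abcU => /=; [left; left|left; right|right].
  case: xabc => [[]|] ->; [exists b, c|exists c, a|exists a, b]; split=> //.
    exact: rot.
  exact/rot/rot.
have [y [z [Uy Uz xyz]]] := cx U xU.
exists x, y, z; split=> //; first by left; left.
by move=> _ [[]|] -> //; exact: nbhs_singleton.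
Qed.

Lemma cycle_point_not_initial x : cycle_point R x -> ~ initial_point R x.
Proof.
move=> /cycle_pointP/(_ _ filterT)[y [z [_ _ /(three_cycleP tR)[_ _ xz]]]].
by move=> /(initial_pointP tR).
Qed.

Lemma cycle_point_not_terminal x : cycle_point R x -> ~ terminal_point R x.
Proof.
move=> /cycle_pointP/(_ _ filterT)[y [z [_ _ /(three_cycleP tR)[yx _ _]]]].
by move=> /(terminal_pointP tR).
Qed.

(** The non-strict conditions [R (y, z)] and [R (z, x)] cut out the same set as
    the strict ones: they could differ only at [z = y] or [z = x], where the
    other condition would give [R (y, x)]. *)
Lemma clopen_three_cycle x y :
  ~ R (y, x) -> clopen [set z | three_cycle R x y z].
Proof.
move=> yx; have -> : [set z | three_cycle R x y z] =
    [set z | ~ R (z, y)] `&` [set z | ~ R (x, z)].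
  by apply/seteqP; split=> z; [move=> /(three_cycleP tR)[]|
     move=> [? ?]; exact/(three_cycleP tR)].
split; first by apply: openI; [exact: open_strict_out|exact: open_strict_in].
suff -> : [set z | ~ R (z, y)] `&` [set z | ~ R (x, z)] =
    [set z | R (y, z)] `&` [set z | R (z, x)].
  by apply: closedI; [exact: closed_out|exact: closed_in].
apply/seteqP; split=> z [] /= zy xz.
  by split; [have []:= tournament_total tR y z|
             have []:= tournament_total tR z x].
split=> [zy'|xz'].
  by apply: yx; rewrite (tournament_antisym tR zy zy').
by apply: yx; rewrite (tournament_antisym tR xz' xz).
Qed.

(** The usual shape of the connectedness arguments: an open and a closed
    condition that agree on [A], although neither set need be clopen in [X]. *)
Lemma connected_sub_agree {A C D : set X} :
  connected A -> open C -> closed D -> A `&` C = A `&` D ->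
  (A `&` C) !=set0 -> A `<=` C.
Proof.
move=> cA oC cD CD AC0.
have <- : A `&` C = A by apply: cA => //; [exists C|exists D].
by move=> x [].
Qed.

(** The clopen set of points closing the arc from [x] to [y] to a 3-cycle
    contains [z] but not [x]. *)
Lemma connected_no_three_cycle (A : set X) x y z :
  connected A -> A x -> A z -> ~ three_cycle R x y z.
Proof.
move=> cA Ax Az xyz.
have yx : ~ R (y, x) by case: ((three_cycleP tR _ _ _).1 xyz).
have [oC cC] := clopen_three_cycle yx.
have /(_ _ Ax) : A `<=` [set z | three_cycle R x y z].
  by apply: (connected_sub_agree cA oC cC) => //; exists z.
by case=> [[_ _ /(_ erefl)]].
Qed.

(** A point [x] outside [A] would split [A] into the points before it, such as
    [a], and the points after it, such as [b]. *)
Lemma connected_convex (A : set X) a b x :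
  connected A -> A a -> A b -> ~ R (x, a) -> ~ R (b, x) -> A x.
Proof.
move=> cA Aa Ab xa bx; apply: contrapT => nAx.
have AE : A `&` [set y | ~ R (y, x)] = A `&` [set y | R (x, y)].
  apply/seteqP; split=> y [Ay /= yx]; split=> //=.
    by have [] := tournament_total tR y x.
  by move=> yx'; apply: nAx; rewrite -(tournament_antisym tR yx' yx).
have /(_ _ Aa) /= ax : A `<=` [set y | ~ R (y, x)].
  apply: (connected_sub_agree cA (open_strict_out x) (@closed_out x) AE).
  by exists b.
by have [] := tournament_total tR a x.
Qed.

(** Without such an [x], lying strictly after [a] and lying weakly after [b]
    would be the same condition on [A], since a connected set has no 3-cycle;
    it holds at [b] and fails at [a]. *)
Lemma connected_between (A : set X) a b :
  connected A -> A a -> A b -> ~ R (b, a) ->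
  exists x, [/\ A x, ~ R (x, a) & ~ R (b, x)].
Proof.
move=> cA Aa Ab ba; apply: contrapT => nx.
have AE : A `&` [set y | ~ R (y, a)] = A `&` [set y | R (b, y)].
  apply/seteqP; split=> y [Ay /= ya]; split=> //=.
    by apply: contrapT => yb; apply: nx; exists y.
  move=> ya'; apply: (@connected_no_three_cycle A a b y) => //.
  apply/(three_cycleP tR); split=> //.
    by move=> yb; apply: ba; rewrite -(tournament_antisym tR yb ya).
  by move=> ay; apply: ba; rewrite -(tournament_antisym tR ya' ay).
have /(_ _ Aa) : A `<=` [set y | ~ R (y, a)].
  apply: (connected_sub_agree cA (open_strict_out a) (@closed_out b) AE).
  by exists b.
by apply; exact: tournament_refl.
Qed.

(** A point strictly between [a] and [b] in [A] is a cycle point, and a 3-cycle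
    through it in the open interval from [a] to [b] stays in [A] by
    convexity. *)
Lemma connected_arcless (A : set X) a b :
  (forall x, [\/ isolated [set: X] x, initial_point R x,
                 terminal_point R x | cycle_point R x]) ->
  connected A -> A a -> A b -> R (b, a).
Proof.
move=> awR cA Aa Ab; apply: contrapT => ba.
have [x [Ax xa bx]] := connected_between cA Aa Ab ba.
case: (awR x) => [/isolatedTP ox|/(initial_pointP tR)/(_ a)|
    /(terminal_pointP tR)/(_ b)|/cycle_pointP cx] //.
  have /(_ _ Aa) /= ax : A `<=` [set x].
    have cx := @topological_tournament_closed_set1 x.
    by apply: (connected_sub_agree cA ox cx) => //; exists x.
  by apply: xa; rewrite ax; exact: tournament_refl.
have [y [z [[ya yb] [za zb]]]] := cx _
  (filterI (nbhs_strict_out xa) (nbhs_strict_in bx)).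
by apply: (connected_no_three_cycle cA) => //;
  exact: (connected_convex cA Aa Ab).
Qed.

End topological_tournament_theory.

Theorem almost_wac_totally_disconnected {X : topologicalType}
    (R : set (X * X)) :
  almost_wac R -> totally_disconnected [set: X].
Proof.
move=> [_ ttR awR] x _; apply/seteqP; split=> [y [A [Ax _ cA] Ay]|_ ->].
  have [_ tR _] := ttR.
  by apply: (tournament_antisym tR); exact: (connected_arcless ttR awR cA).
exact: connected_component_refl.
Qed.

(** * Reversal and extreme points *)

Section reverse.
Context {X : topologicalType} {R : set (X * X)}.

Lemma topological_tournament_reverse :
  topological_tournament R -> topological_tournament R^-1%relation.
Proof.
move=> [hX tR cR]; split => //; first exact: tournament_reverse.
apply: (@closed_pair_preimage _ _ _ snd fst cR) => p;
  [exact: cvg_snd|exact: cvg_fst].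
Qed.

Lemma three_cycle_reverse x y z :
  tournament R -> three_cycle R x y z -> three_cycle R^-1%relation x z y.
Proof.
move=> tR /(three_cycleP tR)[yx zy xz].
by apply/(three_cycleP (tournament_reverse tR)); split.
Qed.

Lemma cycle_point_reverse x :
  topological_tournament R -> cycle_point R x -> cycle_point R^-1%relation x.
Proof.
move=> ttR /(cycle_pointP ttR) cx.
apply/(cycle_pointP (topological_tournament_reverse ttR)) => U.
move=> /cx[y [z [Uy Uz c]]].
exists z, y; split => //; apply: three_cycle_reverse => //.
by case: ttR.
Qed.

Lemma initial_point_reverse x :
  tournament R -> initial_point R x -> terminal_point R^-1%relation x.
Proof.
move=> tR /(initial_pointP tR) ix.
exact/(terminal_pointP (tournament_reverse tR)).
Qed.

Lemma terminal_point_reverse x :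
  tournament R -> terminal_point R x -> initial_point R^-1%relation x.
Proof.
move=> tR /(terminal_pointP tR) ix.
exact/(initial_pointP (tournament_reverse tR)).
Qed.

Lemma wac_reverse : wac R -> wac R^-1%relation.
Proof.
move=> [cX ttR wR]; split=> //; first exact: topological_tournament_reverse.
by move=> x /wR; exact: cycle_point_reverse.
Qed.

Lemma almost_wac_reverse : almost_wac R -> almost_wac R^-1%relation.
Proof.
move=> [cX ttR wR]; split=> //; first exact: topological_tournament_reverse.
have [_ tR _] := ttR.
move=> x; have [ix|ix|tx|cx] := wR x; first exact: Or41.
- by apply: Or43; exact: initial_point_reverse.
- by apply: Or42; exact: terminal_point_reverse.
- by apply: Or44; exact: cycle_point_reverse.
Qed.

Lemma locally_arc_cyclic_reverse :
  tournament R -> locally_arc_cyclic R -> locally_arc_cyclic R^-1%relation.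
Proof.
move=> tR lR x; have [U xU aU] := lR x; exists U => // y z Uy Uz.
move=> /(strict_relP (tournament_reverse tR)) yz.
have /(aU _ _ Uz Uy)[t tc] : strict_rel R (z, y) by exact/(strict_relP tR).
exists t; apply: three_cycle_reverse => //.
move/(three_cycleP tR): tc => [? ? ?]; exact/(three_cycleP tR).
Qed.

End reverse.

Lemma wac_almost_wac {X : topologicalType} (R : set (X * X)) :
  wac R -> almost_wac R.
Proof.
move=> [cX ttR wR]; split=> // x.
by have [ix|/wR cx] := pselect (isolated [set: X] x); [exact: Or41|exact: Or44].
Qed.

Lemma wac_extreme_isolated {X : topologicalType} (R : set (X * X)) x :
  wac R -> initial_point R x \/ terminal_point R x -> isolated [set: X] x.
Proof.
move=> [_ ttR wR] ext; apply: contrapT => /wR cx.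
by case: ext; [exact: cycle_point_not_initial|exact: cycle_point_not_terminal].
Qed.

(** * Local arc cyclicity *)

Section locally_arc_cyclic.
Context {X : topologicalType}.
Implicit Types R : set (X * X).

(** By antisymmetry the conclusion holds when [y = x], where the only such [z]
    is [x]; compactness in [z] and closedness of [R] extend it to nearby [y]. *)
Lemma near_small_three_cycle R x (U : set X) :
  compact [set: X] -> topological_tournament R -> nbhs x U ->
  \forall y \near x, forall z, R (x, z) -> R (z, y) -> U z.
Proof.
move=> cX ttR xU; have [_ tR cR] := ttR.
have /compact_near_coveringP ncX := cX.
suff : \forall y \near x, [set: X] `<=` (fun z => R (x, z) -> R (z, y) -> U z).
  by apply: filterS => y + z; apply.
apply: ncX => z _.
have [->|/eqP zx] := eqVneq z x.
  exists (U, setT) => /=; first by split=> //; exact: filterT.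
  by move=> [? ?] [? _] _ _.
have [xz|xz] := pselect (R (x, z)); last first.
  exists ([set y | ~ R (x, y)], setT) => /=.
    by split; [exact: nbhs_strict_in|exact: filterT].
  by move=> [? ?] [? _].
have : nbhs (z, x) (~` R).
  apply: open_nbhs_nbhs; split; first exact: closed_openC.
  by move=> zx'; apply: zx; exact: (tournament_antisym tR).
move=> [[V W] /= [zV xW] VWR]; exists (V, W) => //= -[z' y] [/= Vz' Wy] _ zy.
by have := VWR (z', y) (conj Vz' Wy).
Qed.

(** Arcs into [x] from arbitrarily close points [y] are closed to 3-cycles by a
    third point, which [near_small_three_cycle] puts close to [x]. *)
Lemma locally_arc_cyclic_cycle_point R x :
  compact [set: X] -> topological_tournament R -> locally_arc_cyclic R ->
  (forall U, nbhs x U -> exists2 y, U y & ~ R (x, y)) -> cycle_point R x.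
Proof.
move=> cX ttR lR accx; have [_ tR _] := ttR.
apply/(cycle_pointP ttR) => U xU; have [W xW aW] := lR x.
have [y [[Uy Wy] yU xy]] :=
  accx _ (filterI (filterI xU xW) (near_small_three_cycle cX ttR xU)).
have [|z yxz] := aW y x Wy (nbhs_singleton xW).
  exact/(strict_relP tR).
have /(three_cycleP tR)[xy' zx yz] := yxz.
exists z, y; split=> //; last by apply/(three_cycleP tR); split.
by apply: yU; [have [] := tournament_total tR x z|
               have [] := tournament_total tR z y].
Qed.

Theorem locally_arc_cyclic_wac R :
  compact [set: X] -> topological_tournament R -> locally_arc_cyclic R -> wac R.
Proof.
move=> cX ttR lR; have [_ tR _] := ttR; split=> // x nix.
have [accx|] := pselect (forall U, nbhs x U -> exists2 y, U y & ~ R (x, y)).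
  exact: locally_arc_cyclic_cycle_point.
move=> /existsNP[U /not_implyP[xU nU]].
have -> : R = (R^-1)^-1%relation by apply/seteqP; split=> -[].
apply: cycle_point_reverse.
  exact: topological_tournament_reverse.
apply: locally_arc_cyclic_cycle_point => //.
- exact: topological_tournament_reverse.
- exact: locally_arc_cyclic_reverse.
move=> V xV; apply: contrapT => nV; apply: nix.
apply/isolatedTP; suff : nbhs x [set x] by rewrite openE => ? _ ->.
apply: filterS (filterI xU xV) => y [Uy Vy]; apply: (tournament_antisym tR).
  by apply: contrapT => yx; apply: nV; exists y.
by apply: contrapT => yx; apply: nU; exists y.
Qed.

Lemma finite_tournament_properties R :
  hausdorff_space X -> finite_set [set: X] -> tournament R ->
  [/\ compact [set: X], topological_tournament R & locally_arc_cyclic R].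
Proof.
move=> hX fX tR.
have closedX (A : set X) : closed A.
  apply: (accessible_finite_set_closed.1 (hausdorff_accessible hX)).
  exact: sub_finite_set fX.
have openX (A : set X) : open A by rewrite -closedC; exact: closedX.
split; first exact: finite_compact.
  split=> //; rewrite -[R]setCK; apply: open_closedC.
  rewrite openE => -[x y] xy; exists ([set x], [set y]) => /=.
    by split; apply: open_nbhs_nbhs.
  by move=> [? ?] /= [-> ->].
move=> x; exists [set x]; first exact: open_nbhs_nbhs.
by move=> _ _ -> -> [_ /(_ erefl)].
Qed.

End locally_arc_cyclic.

(** * Restrictions *)

Section restriction.
Context {X : topologicalType} {R : set (X * X)} {A : set X}.
Implicit Types x : set_type A.

Lemma topological_tournament_restrict :
  A !=set0 -> topological_tournament R ->
  topological_tournament (restrict_rel R A).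
Proof.
move=> [x Ax]; apply: topological_tournament_pullback.
- by exists (exist _ x (mem_set Ax)).
- exact: initial_continuous.
- exact: val_inj.
Qed.

Lemma compact_set_type :
  compact [set: X] -> closed A -> compact [set: set_type A].
Proof.
move=> cX cA F FF _.
have [p [_ pF]] := cX (\val @ F) _ filterT.
have Ap : A p.
  apply: cA => V; apply: pF.
  suff : F (\val @^-1` A) by [].
  by apply: (filterS (P := setT)) => [x _ /=|]; [have := valP x; rewrite inE|
                                               exact: filterT].
exists (exist _ p (mem_set Ap)); split=> // B V FB.
rewrite nbhsE => -[_ [[W oW <-] Wp] WV].
have FB' : F (\val @^-1` (\val @` B)).
  by apply: (filterS (P := B)) => // x Bx; exists x.
have [_ [[x Bx <-] Wx]] := pF _ _ FB' (open_nbhs_nbhs (conj oW Wp)).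
by exists x; split=> //; exact: WV.
Qed.

Lemma isolated_restrict x :
  isolated [set: X] (\val x) -> isolated [set: set_type A] x.
Proof.
move=> /isolatedTP ox; apply/isolatedTP; exists [set \val x] => //.
by apply/seteqP; split=> [y /= /val_inj|y ->].
Qed.

Lemma initial_point_restrict x :
  tournament R -> initial_point R (\val x) ->
  initial_point (restrict_rel R A) x.
Proof.
move=> tR /(initial_pointP tR) ix.
apply/initial_pointP; last by move=> y; exact: ix.
by apply: tournament_pullback => //; exists x.
Qed.

Lemma terminal_point_restrict x :
  tournament R -> terminal_point R (\val x) ->
  terminal_point (restrict_rel R A) x.
Proof.
move=> tR /(terminal_pointP tR) ix.
apply/terminal_pointP; last by move=> y; exact: ix.
by apply: tournament_pullback => //; exists x.
Qed.

Lemma cycle_point_restrict x :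
  topological_tournament R -> nbhs (\val x) A -> cycle_point R (\val x) ->
  cycle_point (restrict_rel R A) x.
Proof.
move=> ttR xA /(cycle_pointP ttR) cx.
have A0 : A !=set0 by exists (\val x); exact: nbhs_singleton.
have ttA := topological_tournament_restrict A0 ttR.
apply/(cycle_pointP ttA) => U; rewrite nbhsE => -[_ [[W oW <-] Wx] WU].
have [y [z [[Ay Wy] [Az Wz]]]] :=
  cx _ (filterI xA (open_nbhs_nbhs (conj oW Wx))).
have [_ tR _] := ttR; have [_ tA _] := ttA.
move=> /(three_cycleP tR) xyz.
exists (exist _ y (mem_set Ay)), (exist _ z (mem_set Az)).
by split; [exact: WU|exact: WU|exact/(three_cycleP tA)].
Qed.

Lemma wac_restrict : A !=set0 -> clopen A -> wac R -> wac (restrict_rel R A).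
Proof.
move=> A0 [oA cA] [cX ttR wR]; split; first exact: compact_set_type.
  exact: topological_tournament_restrict.
move=> x nix; apply: cycle_point_restrict => //.
  by apply: open_nbhs_nbhs; split=> //; have := valP x; rewrite inE.
by apply: wR => ix; apply: nix; exact: isolated_restrict.
Qed.

Lemma almost_wac_restrict :
  A !=set0 -> clopen A -> almost_wac R -> almost_wac (restrict_rel R A).
Proof.
move=> A0 [oA cA] [cX ttR wR]; split; first exact: compact_set_type.
  exact: topological_tournament_restrict.
have [_ tR _] := ttR.
move=> x; have [ix|ix|tx|cx] := wR (\val x).
- by apply: Or41; exact: isolated_restrict.
- by apply: Or42; exact: initial_point_restrict.
- by apply: Or43; exact: terminal_point_restrict.
apply: Or44; apply: cycle_point_restrict => //.
by apply: open_nbhs_nbhs; split=> //; have := valP x; rewrite inE.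
Qed.

End restriction.

(** Strict out-sets are open, so every point other than [x] is interior to
    [out_set R x] and a cycle point there if it is one in [X]. *)
Lemma wac_out_set {X : topologicalType} (R : set (X * X)) (x : X) :
  wac R ->
  almost_wac (restrict_rel R (out_set R x)) /\
  exists2 x' : set_type (out_set R x), \val x' = x &
    initial_point (restrict_rel R (out_set R x)) x'.
Proof.
move=> [cX ttR wR]; have [_ tR _] := ttR.
have xx : out_set R x x by exact: tournament_refl.
have A0 : out_set R x !=set0 by exists x.
have ttA := topological_tournament_restrict A0 ttR.
have [_ tA _] := ttA.
have ix (x' : set_type (out_set R x)) : \val x' = x ->
    initial_point (restrict_rel R (out_set R x)) x'.
  move=> e; apply/(initial_pointP tA) => y.
  by rewrite /restrict_rel /= e; have := valP y; rewrite inE.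
split; last by exists (exist _ x (mem_set xx)) => //; exact: ix.
split=> //; first by apply: compact_set_type => //; exact: closed_out.
move=> y; have [/ix|yx] := pselect (\val y = x); first exact: Or42.
have [/isolated_restrict|/wR cy] := pselect (isolated [set: X] (\val y)).
  exact: Or41.
apply: Or44; apply: cycle_point_restrict => //.
have xy : R (x, \val y) by have := valP y; rewrite inE.
have : ~ R (\val y, x) by move=> yx'; apply: yx; exact: (tournament_antisym tR).
move=> /(nbhs_strict_out ttR); apply: filterS => z zx.
by have [] := tournament_total tR x z.
Qed.

(** * Tournament maps *)

(** This is closedness of [h], applied to the complement of [U]. *)
Lemma nbhs_preimage_fiber {X Y : topologicalType} (h : X -> Y) (U : set X) y :
  compact [set: X] -> hausdorff_space Y -> continuous h ->
  open U -> h @^-1` [set y] `<=` U ->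
  exists2 V, nbhs y V & h @^-1` V `<=` U.
Proof.
move=> cX hY ch oU yU.
have cC : closed (h @` ~` U).
  apply: compact_closed => //; apply: continuous_compact.
    exact: continuous_subspaceT.
  by apply: (subclosed_compact _ cX) => //; exact: open_closedC.
exists (~` (h @` ~` U)).
  apply: open_nbhs_nbhs; split; first exact: closed_openC.
  by move=> [x Ux hx]; apply/Ux/yU.
by move=> x hx; apply: contrapT => Ux; apply: hx; exists x.
Qed.

Lemma tournament_map_reverse {T2 T1 : Type} (R2 : set (T2 * T2))
    (R1 : set (T1 * T1)) h :
  tournament_map R2 R1 h -> tournament_map R2^-1%relation R1^-1%relation h.
Proof. by move=> hR x y; exact: hR. Qed.

Lemma tournament_map_strict {T2 T1 : Type} (R2 : set (T2 * T2))
    (R1 : set (T1 * T1)) h x y :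
  tournament R1 -> tournament_map R2 R1 h -> R2 (x, y) -> h x <> h y ->
  ~ R1 (h y, h x).
Proof.
move=> tR1 hR xy nxy yx; apply: nxy.
exact: (tournament_antisym tR1 (hR _ _ xy)).
Qed.

Lemma tournament_map_reflects_strict {T2 T1 : Type} (R2 : set (T2 * T2))
    (R1 : set (T1 * T1)) h x y :
  tournament R2 -> tournament_map R2 R1 h -> ~ R1 (h y, h x) -> R2 (x, y).
Proof.
move=> tR2 hR nyx; have [//|yx] := tournament_total tR2 x y.
by case: nyx; exact: hR.
Qed.

(** Suppose that [x], a limit of points outside its fiber, has an arc to a
    point [x'] of the fiber.  Points [z] near [x] outside the fiber have an arc
    to [x'], hence to every point [w] of the fiber (the fact [below] in the
    proof), and this is incompatible with each possible status of [x]. *)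
Lemma fiber_boundary_no_out {X2 X1 : topologicalType}
    (R2 : set (X2 * X2)) (R1 : set (X1 * X1)) (h : X2 -> X1) x x' :
  tournament R1 -> tournament_map R2 R1 h -> almost_wac R2 ->
  ~ nbhs x (h @^-1` [set h x]) -> h x' = h x -> R2 (x', x).
Proof.
move=> tR1 hR [_ ttR2 awR2] nxF hx'; apply: contrapT => x'x.
have [_ tR2 _] := ttR2.
have exit U : nbhs x U -> exists2 z, U z & h z <> h x.
  move=> xU; apply: contrapT => nz; apply: nxF; apply: filterS xU => z Uz.
  by apply: contrapT => hz; apply: nz; exists z.
have below z w : ~ R2 (x', z) -> h z <> h x -> h w = h x -> ~ R2 (w, z).
  move=> x'z zx wx wz; apply: (tournament_map_strict (y := z) tR1 hR wz).
    by rewrite wx; exact: nesym.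
  rewrite wx -hx'; apply: hR.
  by have [] := tournament_total tR2 x' z.
have xU := nbhs_strict_in ttR2 x'x.
have [/isolatedTP ox|/(initial_pointP tR2) ix|/(terminal_pointP tR2) tx|cx] :=
  awR2 x.
- have [z] := exit [set x] (open_nbhs_nbhs (conj ox erefl)).
  by move=> ->.
- have [z /= x'z zx] := exit _ xU.
  exact: (below z x).
- exact: x'x.
have [a [b [x'a x'b]]] := (cycle_pointP ttR2 _).1 cx _ xU.
move=> /(three_cycleP tR2)[ax ba xb].
(* Outside the fiber, [a] would have an arc to [x] and [b] an arc to [a],
   against the orientation of the cycle; the cycle thus lies in the fiber. *)
have ha : h a = h x.
  apply: contrapT => hax; have [ax'|//] := tournament_total tR2 x a.
  exact: (below a x).
have hb : h b = h x.
  apply: contrapT => hbx; have [ab|//] := tournament_total tR2 a b.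
  exact: (below b a).
(* As [b] has an arc to [x], it also has one to the points near [x]. *)
have [z [x'z zb] hz] := exit _ (filterI xU (nbhs_strict_out ttR2 xb)).
have [bz|//] := tournament_total tR2 b z.
exact: (below z b).
Qed.

(** * The topology of the lexicographic product *)

Section lexprod_topology.
Context {X : topologicalType} {Y : X -> topologicalType}.

Lemma lexprod_base_open (B : set (lexprod Y)) : lexprod_base B -> open B.
Proof.
by move=> bB; exists [set B]; [move=> _ ->|rewrite bigcup_set1].
Qed.

Lemma continuous_to_lexprod {Z : topologicalType} (f : Z -> lexprod Y) :
  (forall B, lexprod_base B -> open (f @^-1` B)) -> continuous f.
Proof.
move=> bf; apply/continuousP => A [D DB <-]; rewrite preimage_bigcup.
by apply: bigcup_open => B /DB; exact: bf.
Qed.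

End lexprod_topology.

(** * Factors of almost wac tournaments *)

Section factor.
Context {X2 X1 : topologicalType} {R2 : set (X2 * X2)} {R1 : set (X1 * X1)}.
Context {h : X2 -> X1}.
Hypotheses (ttR1 : topological_tournament R1)
  (hsurj : set_surj [set: X2] [set: X1] h) (hcont : continuous h)
  (hR : tournament_map R2 R1 h) (awR2 : almost_wac R2).

Let tR1 : tournament R1. Proof. by case: ttR1. Qed.
Let hX1 : hausdorff_space X1. Proof. by case: ttR1. Qed.
Let cX2 : compact [set: X2]. Proof. by case: awR2. Qed.
Let ttR2 : topological_tournament R2. Proof. by case: awR2. Qed.
Let tR2 : tournament R2. Proof. by case: ttR2. Qed.

Let surj y : exists x, h x = y.
Proof. by have [x _ <-] := hsurj (I : [set: X1] y); exists x. Qed.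

Lemma open_fiber_isolated y : open (h @^-1` [set y]) -> isolated [set: X1] y.
Proof.
move=> oF; apply/isolatedTP.
have [V yV VF] := nbhs_preimage_fiber cX2 hX1 hcont oF (fun _ => id).
suff : nbhs y [set y] by rewrite openE => ? _ ->.
by apply: filterS yV => z; have [x <-] := surj z; exact: VF.
Qed.

Lemma fiber_nonisolated y : ~ isolated [set: X1] y ->
  exists2 x, h @^-1` [set y] = [set x] & ~ isolated [set: X2] x.
Proof.
move=> niy.
have [x hx nxF] : exists2 x, h x = y & ~ nbhs x (h @^-1` [set y]).
  apply: contrapT => nx; apply/niy/open_fiber_isolated.
  rewrite openE => x hx; apply: contrapT => nxF; apply: nx.
  by exists x.
have Fx : h @^-1` [set y] = [set x].
  apply/seteqP; split=> [x' hx'|_ ->] //=; subst y.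
  apply: (tournament_antisym tR2).
    exact: (fiber_boundary_no_out tR1 hR awR2).
  exact: (fiber_boundary_no_out (tournament_reverse tR1)
    (tournament_map_reverse hR) (almost_wac_reverse awR2)).
exists x => // /isolatedTP ox; apply: nxF.
by rewrite Fx; exact: open_nbhs_nbhs.
Qed.

Lemma terminal_point_map x : terminal_point R2 x -> terminal_point R1 (h x).
Proof.
move=> /(terminal_pointP tR2) tx; apply/(terminal_pointP tR1) => y.
by have [x' <-] := surj y; exact: hR.
Qed.

Lemma initial_point_map x : initial_point R2 x -> initial_point R1 (h x).
Proof.
move=> /(initial_pointP tR2) tx; apply/(initial_pointP tR1) => y.
by have [x' <-] := surj y; exact: hR.
Qed.

Lemma singleton_fiber_terminal x : h @^-1` [set h x] = [set x] ->
  terminal_point R1 (h x) -> terminal_point R2 x.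
Proof.
move=> Fx /(terminal_pointP tR1) tx; apply/(terminal_pointP tR2) => z.
have [//|xz] := tournament_total tR2 z x.
have -> : z = x; last exact: tournament_refl.
have : (h @^-1` [set h x]) z by exact: (tournament_antisym tR1 (tx _) (hR xz)).
by rewrite Fx.
Qed.

Lemma singleton_fiber_initial x : h @^-1` [set h x] = [set x] ->
  initial_point R1 (h x) -> initial_point R2 x.
Proof.
move=> Fx /(initial_pointP tR1) ix; apply/(initial_pointP tR2) => z.
have [//|zx] := tournament_total tR2 x z.
have -> : z = x; last exact: tournament_refl.
have : (h @^-1` [set h x]) z by exact: (tournament_antisym tR1 (hR zx) (ix _)).
by rewrite Fx.
Qed.

(** One arc that is not collapsed suffices: if [h] identified [z] with [x] or
    [y], the two other arcs would map to an arc opposite to that from [h x] to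
    [h y]. *)
Lemma three_cycle_map x y z :
  three_cycle R2 x y z -> h x <> h y -> three_cycle R1 (h x) (h y) (h z).
Proof.
move=> /(three_cycleP tR2)[yx zy xz] nxy.
have total a b : ~ R2 (b, a) -> R2 (a, b).
  by have [] := tournament_total tR2 a b.
have hyx := tournament_map_strict tR1 hR (total _ _ yx) nxy.
apply/(three_cycleP tR1); split=> //.
  apply: (tournament_map_strict tR1 hR (total _ _ zy)) => e.
  by apply: hyx; rewrite e; apply: hR; exact: total.
apply: (tournament_map_strict tR1 hR (total _ _ xz)) => e.
by apply: hyx; rewrite -e; apply: hR; exact: total.
Qed.

Lemma cycle_point_map x :
  h @^-1` [set h x] = [set x] -> cycle_point R2 x -> cycle_point R1 (h x).
Proof.
move=> Fx /(cycle_pointP ttR2) cx; apply/(cycle_pointP ttR1) => V hxV.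
have [y [z [Vy Vz xyz]]] := cx _ (hcont hxV).
exists (h y), (h z); split=> //; apply: three_cycle_map => // hxy.
have yx : y = x by have : (h @^-1` [set h x]) y by []; rewrite Fx.
by move: xyz => [[+ _ _] _]; rewrite yx; apply.
Qed.

Let compact_codomain : compact [set: X1].
Proof.
have -> : [set: X1] = h @` [set: X2] by apply/seteqP; split.
by apply: continuous_compact => //; exact: continuous_subspaceT.
Qed.

Lemma wac_image : wac R2 -> wac R1.
Proof.
move=> [_ _ wR2]; split=> // y /fiber_nonisolated[x Fx /wR2 cx].
have hx : h x = y by have : [set x] x by []; rewrite -Fx.
by rewrite -hx in Fx *; exact: cycle_point_map.
Qed.

Lemma almost_wac_image : almost_wac R1.
Proof.
split=> // y; have [iy|] := pselect (isolated [set: X1] y); first exact: Or41.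
move=> /fiber_nonisolated[x Fx nix].
have hx : h x = y by have : [set x] x by []; rewrite -Fx.
rewrite -hx in Fx *; have [_ _ /(_ x)[//|ix|tx|cx]] := awR2.
- by apply: Or42; exact: initial_point_map.
- by apply: Or43; exact: terminal_point_map.
- by apply: Or44; exact: cycle_point_map.
Qed.

Lemma isolated_fiber_clopen y :
  isolated [set: X1] y -> clopen (h @^-1` [set y]).
Proof.
move=> /isolatedTP oy; split; first by apply: open_comp => // ? _; exact: hcont.
apply: ((continuous_closedP h).1 hcont).
exact: (topological_tournament_closed_set1 ttR1).
Qed.

Lemma nbhs_nonisolated_fiber y x (U : set X2) :
  h @^-1` [set y] = [set x] -> nbhs x U ->
  exists2 V, nbhs y V & h @^-1` V `<=` U.
Proof.
move=> Fx; rewrite nbhsE => -[W [oW Wx] WU].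
have [|V yV VW] := nbhs_preimage_fiber cX2 hX1 hcont oW (y := y).
  by rewrite Fx => _ ->.
by exists V => // z /VW /WU.
Qed.

Lemma open_map_factor : open_map h.
Proof.
move=> U oU; rewrite openE => _ [x Ux <-].
have [/isolatedTP oy|] := pselect (isolated [set: X1] (h x)).
  apply: filterS (open_nbhs_nbhs (conj oy erefl)) => _ ->.
  by exists x.
move=> /fiber_nonisolated[x' Fx' _].
have xx' : x = x' by have : (h @^-1` [set h x]) x by []; rewrite Fx'.
have [|V yV VU] := @nbhs_nonisolated_fiber (h x) x' U Fx'.
  by rewrite -xx'; exact: open_nbhs_nbhs.
apply: filterS yV => y; have [z <-] := surj y => Vz.
by exists z => //; exact: VU.
Qed.

Lemma arc_cyclic_subset_image (B : set X2) :
  arc_cyclic_subset R2 B -> arc_cyclic_subset R1 (h @` B).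
Proof.
move=> aB _ _ [x Bx <-] [y By <-] /(strict_relP tR1) yx.
have [|z xyz] := aB x y Bx By.
  by apply/(strict_relP tR2) => /hR.
exists (h z); apply: three_cycle_map => // e; apply: yx; rewrite e.
exact: tournament_refl.
Qed.

Lemma arc_cyclic_image : arc_cyclic R2 -> arc_cyclic R1.
Proof.
move=> /arc_cyclic_subset_image; rewrite /arc_cyclic.
by have -> : h @` [set: X2] = [set: X1] by apply/seteqP; split.
Qed.

Lemma locally_arc_cyclic_image : locally_arc_cyclic R2 -> locally_arc_cyclic R1.
Proof.
move=> lR2 y; have [x <-] := surj y; have [U xU aU] := lR2 x.
move: xU; rewrite nbhsE => -[W [oW Wx] WU].
exists (h @` W).
  by apply: open_nbhs_nbhs; split; [exact: open_map_factor|exists x].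
by apply: arc_cyclic_subset_image => a b /WU Ua /WU Ub; exact: aU.
Qed.

Lemma lexprod_fiber_admissible : lexprod_admissible (fiber h).
Proof.
move=> y /fiber_nonisolated[x Fx _].
have hx : h x = y by have : [set x] x by []; rewrite -Fx.
exists (exist _ x (mem_set (hx : (h @^-1` [set y]) x))).
apply/seteqP; split=> // -[z zF] _; apply: val_inj => /=.
by have := set_mem zF; rewrite Fx.
Qed.

Definition lexprod_of (x : X2) : lexprod (fiber h) :=
  existT (fiber h) (h x) (exist _ x (mem_set (erefl : (h @^-1` [set h x]) x))).

Definition of_lexprod (p : lexprod (fiber h)) : X2 := \val (projT2 p).

Lemma lexprod_ofK : cancel lexprod_of of_lexprod.
Proof. by []. Qed.

Lemma lexprod_proj_of p : h (of_lexprod p) = lexprod_proj p.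
Proof. by case: p => y [x xF]; exact: set_mem xF. Qed.

Lemma of_lexprodK : cancel of_lexprod lexprod_of.
Proof.
move=> [y [x xF]]; rewrite /of_lexprod /lexprod_of /=.
have hx : h x = y := set_mem xF.
subst y; congr existT; exact: val_inj.
Qed.

Lemma lexprod_of_continuous : continuous lexprod_of.
Proof.
apply: continuous_to_lexprod => _ [[V oV <-]|[y [_ [iy [W oW <-] ->]]]].
  rewrite (_ : _ @^-1` _ = h @^-1` V) //.
  by apply: open_comp => // ? _; exact: hcont.
rewrite (_ : _ @^-1` _ = h @^-1` [set y] `&` W).
  by apply: openI => //; case: (isolated_fiber_clopen iy).
apply/seteqP; split=> [x [[z zF] Wz e]|x [hx Wx]].
  have -> : x = z by rewrite -[LHS](lexprod_ofK x) -e.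
  by split=> //; exact: set_mem zF.
exists (exist _ x (mem_set hx)) => //.
by rewrite -[LHS]of_lexprodK.
Qed.

(** The two kinds of basic open sets serve the two kinds of fibers: a fiber
    over an isolated point is an open piece of the product, while around a
    singleton fiber preimages of open sets of [X1] are arbitrarily small. *)
Lemma of_lexprod_continuous : continuous of_lexprod.
Proof.
apply/continuousP => W oW; rewrite openE => p Wp.
have [iy|] := pselect (isolated [set: X1] (lexprod_proj p)).
  have bB : lexprod_base (existT (fiber h) (lexprod_proj p) @` (\val @^-1` W)).
    by right; exists (lexprod_proj p), (\val @^-1` W); split=> //; exists W.
  apply: filterS (open_nbhs_nbhs (conj (lexprod_base_open bB) _)).
    by move=> _ [x Wx <-].
  by exists (projT2 p) => //; rewrite [RHS]sigT_eta.
move=> /fiber_nonisolated[x Fx _].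
have [|V yV VW] := nbhs_preimage_fiber cX2 hX1 hcont oW (y := lexprod_proj p).
  rewrite Fx => _ ->.
  suff <- : of_lexprod p = x by [].
  have : (h @^-1` [set lexprod_proj p]) (of_lexprod p).
    exact: lexprod_proj_of.
  by rewrite Fx.
move: yV; rewrite nbhsE => -[V' [oV' V'p] V'V].
have bB : lexprod_base (@lexprod_proj _ (fiber h) @^-1` V') by left; exists V'.
apply: filterS (open_nbhs_nbhs (conj (lexprod_base_open bB) V'p)) => q V'q.
by apply: VW; rewrite /preimage /= lexprod_proj_of; exact: V'V.
Qed.

(** Between different fibers [R2] is determined by [R1], and within a fiber the
    product uses [R2] itself. *)
Lemma lexprod_relE :
  lexprod_rel R1 (fiber_rel R2 h) =
  [set p | R2 (of_lexprod p.1, of_lexprod p.2)].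
Proof.
apply/seteqP; split=> -[p q]; rewrite /lexprod_rel /=.
  case=> [/(strict_relP tR1)|[y [a [b [-> ->]]]] //].
  by rewrite -!lexprod_proj_of; exact: (tournament_map_reflects_strict tR2 hR).
move=> pq; have [e|ne] := pselect (lexprod_proj p = lexprod_proj q).
  right; move: p q e pq => [y a] [y' b] /= e; subst y' => ab.
  by exists y, a, b.
left; split=> //=; rewrite -!lexprod_proj_of; exact: hR.
Qed.

Lemma lexprod_of_iso :
  topological_tournament_iso R2 (lexprod_rel R1 (fiber_rel R2 h)) lexprod_of.
Proof.
split=> //.
- rewrite lexprod_relE; apply: topological_tournament_pullback ttR2.
  + by have [[x _] _ _] := tR2; exists (lexprod_of x).
  + exact: of_lexprod_continuous.
  + exact: can_inj of_lexprodK.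
- split; first exact: lexprod_of_continuous.
  exists of_lexprod; split; [exact: lexprod_ofK|exact: of_lexprodK|].
  exact: of_lexprod_continuous.
- by move=> x y xy; rewrite lexprod_relE.
Qed.

End factor.

(** * The theorem *)

Theorem theorem10p2 :
  (* (a) *)
  (forall (X : topologicalType) (R : set (X * X)),
     almost_wac R -> totally_disconnected [set: X]) /\
  (* (b) *)
  ((forall (X : topologicalType) (R : set (X * X)),
      compact [set: X] -> topological_tournament R -> locally_arc_cyclic R ->
      wac R) /\
   (forall (X : topologicalType) (R : set (X * X)),
      hausdorff_space X -> finite_set [set: X] -> tournament R ->
      [/\ compact [set: X], topological_tournament R &
          locally_arc_cyclic R])) /\
  (* (c) *)
  (forall (X : topologicalType) (R : set (X * X)),
     (wac R -> wac R^-1%relation) /\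
     (almost_wac R -> almost_wac R^-1%relation)) /\
  (* (d) *)
  ((forall (X : topologicalType) (R : set (X * X)) (A : set X),
      A !=set0 -> clopen A ->
      (wac R -> wac (restrict_rel R A)) /\
      (almost_wac R -> almost_wac (restrict_rel R A))) /\
   (forall (X : topologicalType) (R : set (X * X)) (x : X),
      wac R ->
      almost_wac (restrict_rel R (out_set R x)) /\
      exists2 x' : set_type (out_set R x), \val x' = x &
        initial_point (restrict_rel R (out_set R x)) x')) /\
  (* (e) *)
  (forall (X : topologicalType) (R : set (X * X)) (x : X),
     wac R -> initial_point R x \/ terminal_point R x ->
     isolated [set: X] x) /\
  (* (f) *)
  (forall (X2 X1 : topologicalType) (R2 : set (X2 * X2)) (R1 : set (X1 * X1))
     (h : X2 -> X1),
     topological_tournament R2 -> topological_tournament R1 ->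
     set_surj [set: X2] [set: X1] h -> continuous h ->
     tournament_map R2 R1 h ->
     wac R2 \/ almost_wac R2 ->
     ((wac R2 -> wac R1) /\ (almost_wac R2 -> almost_wac R1)) /\
     (forall y : X1, ~ isolated [set: X1] y ->
        exists2 x : X2, h @^-1` [set y] = [set x] & ~ isolated [set: X2] x) /\
     (forall x : X2,
        (terminal_point R2 x -> terminal_point R1 (h x)) /\
        (initial_point R2 x -> initial_point R1 (h x))) /\
     (forall y : X1, ~ isolated [set: X1] y ->
        (terminal_point R1 y ->
           exists2 x : X2, h @^-1` [set y] = [set x] & terminal_point R2 x) /\
        (initial_point R1 y ->
           exists2 x : X2, h @^-1` [set y] = [set x] & initial_point R2 x)) /\
     (forall y : X1, isolated [set: X1] y ->
        (wac R2 -> wac (fiber_rel R2 h y)) /\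
        (almost_wac R2 -> almost_wac (fiber_rel R2 h y))) /\
     (lexprod_admissible (fiber h) /\
      exists2 hhat : X2 -> lexprod (fiber h),
        topological_tournament_iso R2 (lexprod_rel R1 (fiber_rel R2 h)) hhat &
        lexprod_proj \o hhat = h) /\
     open_map h /\
     (arc_cyclic R2 -> arc_cyclic R1) /\
     (locally_arc_cyclic R2 -> locally_arc_cyclic R1)).
Proof.
split; first by move=> X R; exact: almost_wac_totally_disconnected.
split.
  split; first by move=> X R; exact: locally_arc_cyclic_wac.
  by move=> X R; exact: finite_tournament_properties.
split.
  by move=> X R; split; [exact: wac_reverse|exact: almost_wac_reverse].
split.
  split; last by move=> X R x; exact: wac_out_set.
  by move=> X R A A0 cA;
    split; [exact: wac_restrict|exact: almost_wac_restrict].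
split; first by move=> X R x; exact: wac_extreme_isolated.
move=> X2 X1 R2 R1 h _ ttR1 hsurj hcont hR wR2.
have awR2 : almost_wac R2 by case: wR2 => // /wac_almost_wac.
have fiberP := fiber_nonisolated ttR1 hsurj hcont hR awR2.
split.
  split; first exact: (wac_image ttR1 hsurj hcont hR awR2).
  by move=> _; exact: (almost_wac_image ttR1 hsurj hcont hR awR2).
split=> //.
split.
  move=> x; split; first exact: (terminal_point_map ttR1 hsurj hR awR2).
  exact: (initial_point_map ttR1 hsurj hR awR2).
split.
  move=> y /fiberP[x Fx _].
  have hx : h x = y by have : [set x] x by []; rewrite -Fx.
  subst y; split=> ext; exists x => //.
    exact: (singleton_fiber_terminal ttR1 hR awR2).
  exact: (singleton_fiber_initial ttR1 hR awR2).
split.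
  move=> y iy; have cF := isolated_fiber_clopen ttR1 hcont iy.
  have F0 : h @^-1` [set y] !=set0.
    by have [x _ hx] := hsurj y I; exists x.
  by split; [exact: wac_restrict|exact: almost_wac_restrict].
split.
  split; first exact: (lexprod_fiber_admissible ttR1 hsurj hcont hR awR2).
  by exists (lexprod_of (h := h)) => //; exact: lexprod_of_iso.
split; first exact: (open_map_factor ttR1 hsurj hcont hR awR2).
split; first exact: (arc_cyclic_image ttR1 hsurj hR awR2).
exact: (locally_arc_cyclic_image ttR1 hsurj hcont hR awR2).
Qed.
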